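(* Let $k\ge 1$ be a fixed integer and let $\mathrm{scw}_{n,k}$ denote the number of smooth cyclic words of length $n$ over the alphabet $[k]$. Then, as $n\to\infty$, $$\mathrm{scw}_{n,k}\sim\left[1+2\cos\Bigl(\frac{\pi}{k+1}\Bigr)\right]^n.$$
   Context: $[k]=\{1,2,\ldots,k\}$, and $[k]^n$ is the set of words $\sigma=\sigma_1\cdots\sigma_n$ of length $n$ over $[k]$. A word $\sigma\in[k]^n$ is smooth if $|\sigma_{i+1}-\sigma_i|\le 1$ for all $1\le i\le n-1$, and smooth cyclic if it is smooth and in addition $|\sigma_n-\sigma_1|\le 1$. The notation $a_n\sim b_n$ means $a_n/b_n\to 1$ as $n\to\infty$. *)

(* Defs.v *)
From HB Require Import structures.
From mathcomp Require Import all_boot all_order all_algebra.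
From mathcomp Require Import all_classical all_reals all_analysis.
Import Order.TTheory GRing.Theory Num.Theory.
Import numFieldNormedType.Exports.

Set Implicit Arguments.
Unset Strict Implicit.
Unset Printing Implicit Defensive.

Local Open Scope nat_scope.

(* The alphabet [k] = {1, ..., k} is represented by 'I_k = {0, ..., k - 1}, the
   letter a standing for a + 1: only differences of letters matter below. *)

Definition close_letters (k : nat) (a b : 'I_k) : bool := (`|a%:Z - b%:Z| <= 1)%R.

Definition smooth (k : nat) (w : seq 'I_k) : bool := sorted (@close_letters k) w.

Definition smooth_cyclic (k : nat) (w : seq 'I_k) : bool :=
  smooth w && (if w is a :: s then close_letters (last a s) a else true).

Definition scw (n k : nat) : nat :=
  #|[set w : n.-tuple 'I_k | smooth_cyclic w]|.

Definition asymp_equiv (R : realType) (a b : nat -> R) : Prop :=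
  ((a n / b n)%R @[n --> \oo] --> (1 : R)%R)%classic.

(* Main.v *)
Require Import Defs.
From HB Require Import structures.
From mathcomp Require Import all_boot all_order all_algebra.
From mathcomp Require Import all_classical all_reals all_analysis.
From mathcomp Require Import zify ring lra.
Import Order.TTheory GRing.Theory Num.Theory.
Import numFieldNormedType.Exports.

(** Let [A] be the 0-1 matrix of the relation [close_letters] on [k] letters.
A smooth cyclic word of length [n >= 1] is a closed walk of length [n] for this
relation, so there are [\tr (A ^+ n)] of them ([scw_trace]).

The matrix [A] is tridiagonal with all its relevant entries equal to 1, and the
identity [sin (x - t) + sin x + sin (x + t) = (1 + 2 cos t) sin x] shows that
the vector with entries [sin ((i + 1) t)], [i < k], is an eigenvector for
[1 + 2 cos t] as soon as it vanishes at the two missing indices [i = -1] and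
[i = k], that is, when [t = j pi / (k + 1)].  For [0 < j <= k] this gives [k]
distinct eigenvalues, hence all of them, and
[scw n k = \sum_(0 < j <= k) (1 + 2 cos (j pi / (k + 1))) ^+ n]
for [n >= 1] ([scw_eigval]).

Since cosine decreases on [0, pi], the term [j = 1] has the largest eigenvalue.
It also wins in absolute value ([eigval_lt_norm]): the smallest eigenvalue is
the one of [j = k], and [cos (k pi / (k + 1)) = - cos (pi / (k + 1))] shows that
it is 2 minus the largest one.  After division by the [n]-th power of the
largest eigenvalue, the other terms are geometric sequences tending to 0. *)

Local Open Scope ring_scope.

(** * Closed walks and traces *)

Lemma big_tuple_cons (V : nmodType) (T : finType) (n : nat)
    (F : n.+1.-tuple T -> V) :
  \sum_w F w = \sum_a \sum_(t : n.-tuple T) F (cons_tuple a t).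
Proof.
rewrite pair_bigA /=.
rewrite (reindex (fun p : T * n.-tuple T => cons_tuple p.1 p.2)) //=.
exists (fun w => (thead w, behead_tuple w)) => [[a t] _|w _] /=.
  by rewrite theadE; congr (_, _); apply: val_inj.
by rewrite [w in RHS]tuple_eta; apply: val_inj.
Qed.

(** Powers of an adjacency matrix count walks by their two endpoints; a walk is
recorded as its starting point [a] together with the [n] later letters. *)
Lemma adjacency_exp (R : pzSemiRingType) (m : nat) (e : rel 'I_m.+1)
    (n : nat) (a b : 'I_m.+1) :
  ((\matrix_(i, j) (e i j)%:R : 'M[R]_m.+1) ^+ n) a b =
  \sum_(w : n.-tuple 'I_m.+1) (path e a w && (last a w == b))%:R.
Proof.
elim: n a => [|n IHn] a.
  rewrite expr0 mxE (big_pred1 [tuple of [::]]) //= => w.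
  by rewrite [w]tuple0 [RHS]eqxx.
rewrite exprS mxE big_tuple_cons; apply: eq_bigr => c _.
rewrite IHn mxE big_distrr /=; apply: eq_bigr => w _.
by rewrite -andbA; case: (e a c); rewrite ?mul1r ?mul0r.
Qed.

(** A closed walk [a, w] repeats its starting point as the last letter of [w],
so it is determined by [w], and the condition on [w] is smooth cyclicity: the
step from [a = last a w] to the head of [w] is the wrap-around condition.  This
needs [w] to be nonempty, since the empty word would be counted once per [a]. *)
Lemma scw_trace (R : pzSemiRingType) (n m : nat) :
  (scw n.+1 m.+1)%:R =
  \tr ((\matrix_(i, j) (close_letters i j)%:R : 'M[R]_m.+1) ^+ n.+1).
Proof.
rewrite /mxtrace (eq_bigr _ (fun i _ => @adjacency_exp _ _ _ _ i i)).
rewrite exchange_big /= /scw -sum1dep_card natr_sum big_mkcond /=.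
apply: eq_bigr => w _; case/tupleP: w => a t /=.
(* Only the starting point equal to the last letter contributes. *)
rewrite (bigD1 (last a t)) //= eqxx andbT big1 ?addr0 => [|b /negbTE lb].
  by rewrite /smooth_cyclic /smooth /= andbC; case: ifP.
by rewrite [last a t == b]eq_sym lb andbF.
Qed.

(** * The letters close to a given one *)

Lemma close_lettersE (k : nat) (a b : 'I_k) :
  close_letters a b = ((a <= b.+1) && (b <= a.+1))%N.
Proof. rewrite /close_letters; lia. Qed.

(** The two vanishing conditions make the boundary letters behave like interior
ones: [f] is indexed by [0 .. k + 1], the letter [l] sitting at [l + 1], and the
neighbours that the first and the last letter lack contribute 0. *)
Lemma sum_close_letters (V : nmodType) (k : nat) (f : nat -> V) (i : 'I_k) :
  f 0%N = 0 -> f k.+1 = 0 ->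
  \sum_(l < k | close_letters l i) f l.+1 = f i + f i.+1 + f i.+2.
Proof.
move=> f0 fk; have ik := ltn_ord i.
pose g j := \sum_(1 <= l < k.+1 | l == j) f l.
have gE j : (j <= k.+1)%N -> g j = f j.
  rewrite /g big_nat1_eq; case: ifP => // /negbT jk jk1.
  have /orP[/eqP->|/eqP->] : (j == 0)%N || (j == k.+1) by lia.
    by rewrite f0.
  by rewrite fk.
have/and3P[i0 i1 i2] : [&& i <= k.+1, i.+1 <= k.+1 & i.+2 <= k.+1]%N by lia.
rewrite -(gE i) // -(gE i.+1) // -(gE i.+2) // /g.
rewrite [X in X + _ + _]big_mkcond [X in _ + X + _]big_mkcond.
rewrite [X in _ + _ + X]big_mkcond -!big_split /= big_add1 /= big_mkord.
rewrite big_mkcond; apply: eq_bigr => l _; rewrite close_lettersE.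
case: ifP => h; (do 3![case: eqP => ?]); rewrite ?addr0 ?add0r //; lia.
Qed.

(** * Traces of powers from eigenvectors *)

Section SymmetricDiagonalization.
Variables (F : realFieldType) (m : nat) (A S : 'M[F]_m.+1) (d : 'rV[F]_m.+1).
Hypothesis A_sym : A^T = A.
(* The rows of S are left eigenvectors of A. *)
Hypothesis SA : S *m A = diag_mx d *m S.
Hypothesis S_neq0 : forall i, exists j, S i j != 0.
Hypothesis d_inj : injective (d 0).

(** Eigenvectors of a symmetric matrix for distinct eigenvalues are orthogonal:
the Gram matrix [S *m S^T] commutes with a diagonal matrix whose entries are
distinct, hence it is diagonal, and its diagonal entries are sums of squares. *)
Lemma eigenrows_unit : S \in unitmx.
Proof.
have comm : S *m S^T *m diag_mx d = diag_mx d *m (S *m S^T).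
  rewrite mulmxA -SA -!mulmxA; congr (_ *m _).
  by rewrite -[LHS]trmxK trmx_mul trmxK tr_diag_mx -SA trmx_mul A_sym.
have offdiag i j : i != j -> (S *m S^T) i j = 0.
  move=> ij; move/matrixP/(_ i j): comm.
  rewrite mul_mx_diag mul_diag_mx [LHS]mxE [RHS]mxE => /eqP.
  rewrite mulrC -subr_eq0 -mulrBl mulf_eq0 subr_eq0 => /orP[/eqP/d_inj ji|/eqP//].
  by rewrite ji eqxx in ij.
suff: S *m S^T \in unitmx by rewrite unitmx_mul => /andP[].
have -> : S *m S^T = diag_mx (\row_i (S *m S^T) i i).
  apply/matrixP => i j; rewrite [RHS]mxE [in RHS]mxE.
  by have [->|/offdiag->] := eqVneq i j.
rewrite unitmxE det_diag unitfE; apply/prodf_neq0 => i _.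
rewrite mxE gt_eqF // mxE; have [j Sij] := S_neq0 i.
under eq_bigr do rewrite mxE -expr2.
rewrite lt_def sumr_ge0 ?andbT => [|l _]; last exact: sqr_ge0.
rewrite psumr_eq0 => [|l _]; last exact: sqr_ge0.
by apply/allPn; exists j; rewrite ?mem_index_enum // sqrf_eq0.
Qed.

Lemma trace_exp_eigenrows n : \tr (A ^+ n) = \sum_j d 0 j ^+ n.
Proof.
have SAn : S *m A ^+ n = diag_mx (\row_j d 0 j ^+ n) *m S.
  elim: n => [|n IHn].
    rewrite expr0 mulmx1 (_ : diag_mx _ = 1%:M) ?mul1mx //.
    by apply/matrixP => i j; rewrite !mxE expr0.
  rewrite exprS mulmxA SA -mulmxA IHn mulmxA mulmx_diag; congr (diag_mx _ *m _).
  by apply/rowP => j; rewrite !mxE exprS.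
have -> : A ^+ n = invmx S *m (S *m A ^+ n) by rewrite mulKmx // eigenrows_unit.
rewrite SAn mxtrace_mulC -mulmxA mulmxV ?eigenrows_unit // mulmx1 mxtrace_diag.
by apply: eq_bigr => j _; rewrite mxE.
Qed.
End SymmetricDiagonalization.

(** * The spectrum of the adjacency matrix *)

Lemma sin_natMpi (R : realType) (n : nat) : sin (n%:R * pi) = 0 :> R.
Proof.
elim: n => [|n IHn]; first by rewrite mul0r sin0.
by rewrite -natr1 mulrDl mul1r sinDpi IHn oppr0.
Qed.

Section Spectrum.
Variables (R : realType) (m : nat).

(** The alphabet has [m + 1] letters; this is [j pi / (k + 1)] for [k = m + 1]. *)
Definition angle (j : nat) : R := j%:R * (pi / m.+2%:R).
Definition eigval (j : nat) : R := 1 + 2 * cos (angle j).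

Lemma angle_itv j : (j <= m.+2)%N -> angle j \in `[0, pi].
Proof.
move=> jm; rewrite in_itv /= /angle mulrCA mulr_ge0 ?pi_ge0 //=.
by rewrite ler_piMr ?pi_ge0 // ler_pdivrMr // mul1r ler_nat.
Qed.

Lemma angle_lt i j : (angle i < angle j) = (i < j)%N.
Proof. by rewrite ltr_pM2r ?ltr_nat // divr_gt0 ?pi_gt0. Qed.

Lemma angle_last : angle m.+2 = pi.
Proof. by rewrite /angle mulrC divfK. Qed.

Lemma angleMC i j : i%:R * angle j = j%:R * angle i.
Proof. by rewrite /angle mulrCA. Qed.

Lemma eigval_lt i j : (i <= m.+2)%N -> (j <= m.+2)%N ->
  (eigval i < eigval j) = (j < i)%N.
Proof.
move=> im jm; rewrite ltrD2l ltr_pM2l // ltr_cos ?angle_itv //.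
exact: angle_lt.
Qed.

(** The vanishing of [sin (l t)] at [l = 0] and [l = m + 2] for
[t = angle j.+1] is what allows [sum_close_letters] to turn the eigenvector
equation into the sum formulas for the sine. *)
Lemma scw_eigval n :
  (scw n.+1 m.+1)%:R = \sum_(j < m.+1) eigval j.+1 ^+ n.+1 :> R.
Proof.
pose S : 'M[R]_m.+1 := \matrix_(j, i) sin (i.+1%:R * angle j.+1).
pose d : 'rV[R]_m.+1 := \row_j eigval j.+1.
rewrite scw_trace (@trace_exp_eigenrows _ _ _ S d).
- by apply: eq_bigr => j _; rewrite mxE.
- apply/matrixP => i j; rewrite !mxE; congr (_%:R).
  by rewrite !close_lettersE andbC.
- apply/matrixP => j i; rewrite mul_diag_mx !mxE.
  pose f l := sin (l%:R * angle j.+1).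
  transitivity (\sum_(l < m.+1 | close_letters l i) f l.+1).
    rewrite [RHS]big_mkcond; apply: eq_bigr => l _; rewrite !mxE.
    by case: ifP; rewrite ?mulr1 ?mulr0.
  rewrite sum_close_letters /f ?mul0r ?sin0 //.
    rewrite /eigval.
    have -> : i%:R * angle j.+1 = i.+1%:R * angle j.+1 - angle j.+1.
      by rewrite -natr1; ring.
    have -> : i.+2%:R * angle j.+1 = i.+1%:R * angle j.+1 + angle j.+1.
      by rewrite -[i.+2%:R]natr1; ring.
    by rewrite sinB sinD; ring.
  by rewrite angleMC angle_last sin_natMpi.
- (* The first entry of the row is the sine of an angle between 0 and pi. *)
  move=> j; exists ord0; rewrite mxE mul1r gt_eqF // sin_gt0_pi //.
  apply/andP; split; first by rewrite mulr_gt0 ?divr_gt0 ?pi_gt0.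
  by rewrite -angle_last angle_lt ltnS ltn_ord.
- move=> i j; rewrite !mxE => eqd; apply: val_inj; apply/eqP.
  have im : (i.+1 <= m.+2)%N by rewrite ltnW // ltnS.
  have jm : (j.+1 <= m.+2)%N by rewrite ltnW // ltnS.
  have ij := eigval_lt _ _ im jm; have ji := eigval_lt _ _ jm im.
  by move: ij ji; rewrite eqd ltxx !ltnS; case: ltngtP.
Qed.

(** The angles of indices [m + 1] and 1 are supplementary. *)
Lemma eigval_last : eigval m.+1 = 2 - eigval 1.
Proof.
rewrite /eigval (_ : angle m.+1 = pi - angle 1).
  by rewrite cosB cospi sinpi; ring.
by rewrite -angle_last /angle -[m.+2%:R]natr1; ring.
Qed.

Lemma eigval1_gt0 : 0 < eigval 1.
Proof.
have : eigval m.+1 <= eigval 1 by rewrite leNgt eigval_lt.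
rewrite eigval_last; lra.
Qed.

(** The index 1 has the largest eigenvalue and the index [m + 1] the smallest,
which is [2 - eigval 1] and thus exceeds [- eigval 1]. *)
Lemma eigval_lt_norm j : (1 < j <= m.+1)%N -> `|eigval j| < eigval 1.
Proof.
move=> /andP[j1 jm].
have low : 2 - eigval 1 <= eigval j.
  by rewrite -eigval_last leNgt eigval_lt ?ltnS -?leqNgt // ltnW.
have high : eigval j < eigval 1 by rewrite eigval_lt // ltnW.
by rewrite ltr_norml high andbT (lt_le_trans _ low) // ltrDr.
Qed.

End Spectrum.

(** * Asymptotics *)

Theorem corollary3p4 (R : realType) (k : nat) (hk : (1 <= k)%N) :
  asymp_equiv (fun n : nat => (scw n k)%:R : R)
    (fun n : nat => (1 + 2 * cos (pi / (k.+1)%:R)) ^+ n).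
Proof.
case: k hk => // m _; rewrite /asymp_equiv.
have -> : 1 + 2 * cos (pi / m.+2%:R) = eigval R m 1.
  by rewrite /eigval /angle mul1r.
(* The trace formula holds for nonempty words only, hence the shift. *)
rewrite -cvg_shiftS /=.
pose r (j : 'I_m) : R := eigval R m j.+2 / eigval R m 1.
have ratioE n : (scw n.+1 m.+1)%:R / eigval R m 1 ^+ n.+1 =
    1 + \sum_j r j ^+ n.+1.
  have e1 : eigval R m 1 ^+ n.+1 != 0 by rewrite expf_neq0 // gt_eqF // eigval1_gt0.
  rewrite scw_eigval big_ord_recl mulrDl divff //; congr (_ + _).
  by rewrite mulr_suml; apply: eq_bigr => j _; rewrite expr_div_n.
under eq_fun do rewrite ratioE.
have cvg_tail : ((\sum_j r j ^+ n.+1) @[n --> \oo] --> \sum_(j < m) (0 : R))%classic.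
  apply: cvg_big => [|j _]; first exact: add_continuous.
  have := @cvg_expr R (r j); rewrite -cvg_shiftS; apply.
  rewrite normrM normfV (gtr0_norm (eigval1_gt0 R m)).
  rewrite ltr_pdivrMr ?eigval1_gt0 // mul1r eigval_lt_norm //=.
  by rewrite ltnS.
have := cvgD (cvg_cst (1 : R) (F := \oo%classic)) cvg_tail.
by rewrite big1_eq addr0; apply.
Qed.
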